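(* Let $A\in\mathbb{R}^{n\times n}$ be an irreducible $M$-matrix, $\mathbf{a}\in\mathbb{R}^n$ with $\mathbf{a}>0$, $\Gamma>0$, and let $\eta>0$ be a fixed constant. Let $\mathbf{u}_k>0$ be a unit vector, put $\lambda_k=\min\big(\mathcal{A}(\mathbf{u}_k)\mathbf{u}_k/\mathbf{u}_k\big)$, and suppose $\mathbf{u}_k$ is not an eigenvector, i.e. $\mathbf{r}(\mathbf{u}_k,\lambda_k)\neq 0$. Let $\Delta_k,\delta_k,\mathbf{h}_k(\theta)$ and the constant $M$ be as in the context. Suppose $\theta_k>0$, together with the vector $\mathbf{w}_{k+1}=\mathbf{u}_k+\theta_k\Delta_k$, satisfies $$\theta_k=\begin{cases}1 & \text{if } \mathbf{h}_k(1)\ \ge\ \dfrac{\delta_k\mathbf{u}_k}{(1+\eta)\|\mathbf{w}_{k+1}\|},\\[2mm] \eta_k & \text{otherwise,}\end{cases}$$ where, in the ''otherwise'' case (and only then), $\eta_k$ is given by $$\eta_k=\frac{\eta\,\delta_k\min(\mathbf{u}_k)}{(1+\eta)M\,\|\mathbf{w}_{k+1}\|\,\|\Delta_k\|^2}.$$ Let $\mathbf{u}_{k+1}=\mathbf{w}_{k+1}/\|\mathbf{w}_{k+1}\|$ and $\lambda_{k+1}=\min\big(\mathcal{A}(\mathbf{u}_{k+1})\mathbf{u}_{k+1}/\mathbf{u}_{k+1}\big)$. Then $0<\eta_k<1$ whenever $\eta_k$ is defined, and $$\lambda_k<\lambda_{k+1}<\|A\|+(1+n)\Gamma .$$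
   Context: Inequalities between vectors or matrices are entrywise; $\|\cdot\|$ is the 2-norm; $\mathbf{v}^{[m]}$ denotes the entrywise power and quotients of vectors are entrywise; $\mathbf{e}=[1,\dots,1]^T$; $\mathrm{diag}(\mathbf{v})$ is the diagonal matrix with diagonal $\mathbf{v}$; $\min(\mathbf{v})=\min_i v_i$ and $\min(\mathbf{w}/\mathbf{v})=\min_i w_i/v_i$. A $Z$-matrix is a real square matrix with nonpositive off-diagonal entries; an $M$-matrix is a $Z$-matrix $A$ with $A^{-1}\ge 0$ (in particular it is nonsingular). $A$ is irreducible if there is no nonempty proper subset $S\subset\{1,\dots,n\}$ with $A_{ij}=0$ for all $i\in S$, $j\notin S$. For $\mathbf{u}\in\mathbb{R}^n$, $\lambda\in\mathbb{R}$ put $$\mathcal{A}(\mathbf{u})=A+\Gamma\,\mathrm{diag}\Big(\mathbf{e}-\frac{\mathbf{e}}{\mathbf{a}+\mathbf{u}^{[2]}}\Big),\quad \mathbf{r}(\mathbf{u},\lambda)=\mathcal{A}(\mathbf{u})\mathbf{u}-\lambda\mathbf{u},$$ $$J(\mathbf{u},\lambda)=A+(\Gamma-\lambda)I-\Gamma\,\mathrm{diag}\Big(\frac{\mathbf{a}-\mathbf{u}^{[2]}}{(\mathbf{a}+\mathbf{u}^{[2]})^{[2]}}\Big).$$ For a unit vector $\mathbf{u}_k>0$ and $\lambda_k=\min(\mathcal{A}(\mathbf{u}_k)\mathbf{u}_k/\mathbf{u}_k)$, let $(\Delta_k,\delta_k)\in\mathbb{R}^n\times\mathbb{R}$ be the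 (unique) solution of $$\begin{bmatrix}J(\mathbf{u}_k,\lambda_k)&-\mathbf{u}_k\\-\mathbf{u}_k^T&0\end{bmatrix}\begin{bmatrix}\Delta_k\\ \delta_k\end{bmatrix}=-\begin{bmatrix}\mathbf{r}(\mathbf{u}_k,\lambda_k)\\ \tfrac12(1-\mathbf{u}_k^T\mathbf{u}_k)\end{bmatrix}.$$ For $\theta\in(0,1]$ set $$\mathbf{h}_k(\theta)=\mathbf{r}\Big(\frac{\mathbf{u}_k+\theta\Delta_k}{\|\mathbf{u}_k+\theta\Delta_k\|},\lambda_k\Big),\qquad \mathbf{R}_k(\theta)=\mathbf{h}_k(\theta)-\frac{1-\theta}{\|\mathbf{u}_k+\theta\Delta_k\|}\mathbf{r}(\mathbf{u}_k,\lambda_k)-\frac{\theta\delta_k}{\|\mathbf{u}_k+\theta\Delta_k\|}\mathbf{u}_k .$$ $M>0$ is a fixed constant such that $\|\mathbf{R}_k(\theta)\|\le M\theta^2\|\Delta_k\|^2$ for every unit vector $\mathbf{u}_k>0$ and every $\theta\in(0,1]$. The vector $\mathbf{w}_{k+1}=\mathbf{u}_k+\theta_k\Delta_k$ depends on $\theta_k$, so the rule for $\theta_k$ is an implicit condition on $\theta_k$. *)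

(* Defs.v *)
From mathcomp Require Import all_boot all_order all_algebra.
From mathcomp Require Import classical_sets reals.

Set Implicit Arguments.
Unset Strict Implicit.
Unset Printing Implicit Defensive.

Import Order.TTheory GRing.Theory Num.Theory.
Local Open Scope ring_scope.

Definition entry_le (R : realType) (m n : nat) (X Y : 'M[R]_(m, n)) : bool :=
  [forall i, forall j, X i j <= Y i j].

Definition entry_lt (R : realType) (m n : nat) (X Y : 'M[R]_(m, n)) : bool :=
  [forall i, forall j, X i j < Y i j].

Definition vsqr (R : realType) (n : nat) (v : 'cV[R]_n) : 'cV[R]_n :=
  map_mx (fun x => x ^+ 2) v.

Definition vdiv (R : realType) (n : nat) (w v : 'cV[R]_n) : 'cV[R]_n :=
  map2_mx (fun x y => x / y) w v.

Definition vone (R : realType) (n : nat) : 'cV[R]_n := const_mx 1.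

Definition vdiag (R : realType) (n : nat) (v : 'cV[R]_n) : 'M[R]_n :=
  diag_mx v^T.

                                                                              
                                                                         
Definition vmin (R : realType) (n : nat) (v : 'cV[R]_n.+1) : R :=
  \big[Num.min/v ord0 ord0]_(i < n.+1) v i ord0.

                                                                        
                   
Definition norm2 (R : realType) (n : nat) (v : 'cV[R]_n) : R :=
  Num.sqrt (\sum_(i < n) v i ord0 ^+ 2).

Definition opnorm2 (R : realType) (n : nat) (A : 'M[R]_n) : R :=
  sup [set norm2 (A *m x) | x in [set x : 'cV[R]_n | norm2 x = 1]]%classic.

Definition Zmatrix (R : realType) (n : nat) (A : 'M[R]_n) : Prop :=
  forall i j : 'I_n, i != j -> A i j <= 0.

Definition Mmatrix (R : realType) (n : nat) (A : 'M[R]_n) : Prop :=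
  [/\ Zmatrix A, A \in unitmx & entry_le 0 (invmx A)].

Definition irreducible_mx (R : realType) (n : nat) (A : 'M[R]_n) : Prop :=
  ~ exists S : {set 'I_n},
      [/\ S != finset.set0, S \proper [set: 'I_n] &
          forall i j : 'I_n, i \in S -> j \notin S -> A i j = 0].

Definition calA (R : realType) (n : nat) (A : 'M[R]_n) (Gamma : R)
    (a u : 'cV[R]_n) : 'M[R]_n :=
  A + Gamma *: vdiag (vone R n - vdiv (vone R n) (a + vsqr u)).

Definition resid (R : realType) (n : nat) (A : 'M[R]_n) (Gamma : R)
    (a u : 'cV[R]_n) (lambda : R) : 'cV[R]_n :=
  calA A Gamma a u *m u - lambda *: u.

Definition jacobian (R : realType) (n : nat) (A : 'M[R]_n) (Gamma : R)
    (a u : 'cV[R]_n) (lambda : R) : 'M[R]_n :=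
  A + (Gamma - lambda)%:M
    - Gamma *: vdiag (vdiv (a - vsqr u) (vsqr (a + vsqr u))).

Definition lambda_min (R : realType) (n : nat) (A : 'M[R]_n.+1) (Gamma : R)
    (a u : 'cV[R]_n.+1) : R :=
  vmin (vdiv (calA A Gamma a u *m u) u).

Definition newton_step (R : realType) (n : nat) (A : 'M[R]_n) (Gamma : R)
    (a u : 'cV[R]_n) (lambda : R) (Delta : 'cV[R]_n) (delta : R) : Prop :=
  block_mx (jacobian A Gamma a u lambda) (- u) (- u^T) (0 : 'M[R]_1)
    *m col_mx Delta (delta%:M : 'M[R]_1)
  = - col_mx (resid A Gamma a u lambda) (2^-1 *: (1%:M - u^T *m u)).

Definition normalize2 (R : realType) (n : nat) (w : 'cV[R]_n) : 'cV[R]_n :=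
  (norm2 w)^-1 *: w.

Definition hvec (R : realType) (n : nat) (A : 'M[R]_n) (Gamma : R)
    (a u : 'cV[R]_n) (lambda : R) (Delta : 'cV[R]_n) (theta : R) : 'cV[R]_n :=
  resid A Gamma a (normalize2 (u + theta *: Delta)) lambda.

Definition Rvec (R : realType) (n : nat) (A : 'M[R]_n) (Gamma : R)
    (a u : 'cV[R]_n) (lambda : R) (Delta : 'cV[R]_n) (delta theta : R) :
    'cV[R]_n :=
  hvec A Gamma a u lambda Delta theta
    - ((1 - theta) / norm2 (u + theta *: Delta)) *: resid A Gamma a u lambda
    - (theta * delta / norm2 (u + theta *: Delta)) *: u.

Definition remainder_bound (R : realType) (n : nat) (A : 'M[R]_n.+1)
    (Gamma : R) (a : 'cV[R]_n.+1) (M : R) : Prop :=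
  forall (u Delta : 'cV[R]_n.+1) (delta theta : R),
    entry_lt 0 u -> norm2 u = 1 ->
    newton_step A Gamma a u (lambda_min A Gamma a u) Delta delta ->
    0 < theta <= 1 ->
    norm2 (Rvec A Gamma a u (lambda_min A Gamma a u) Delta delta theta)
      <= M * theta ^+ 2 * norm2 Delta ^+ 2.

                                                                              
                                                                              
Definition full_step_test (R : realType) (n : nat) (A : 'M[R]_n) (Gamma : R)
    (a u : 'cV[R]_n) (lambda : R) (Delta : 'cV[R]_n) (delta eta : R)
    (w : 'cV[R]_n) : bool :=
  entry_le ((delta / ((1 + eta) * norm2 w)) *: u) (hvec A Gamma a u lambda Delta 1).

Definition damped_step (R : realType) (n : nat) (u Delta : 'cV[R]_n.+1)
    (delta eta M : R) (w : 'cV[R]_n.+1) : R :=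
  eta * delta * vmin u / ((1 + eta) * M * norm2 w * norm2 Delta ^+ 2).

(* Main.v *)
(** The Jacobian dominates [calA(u) - lambda] by a positive diagonal, so it is a
    Z-matrix mapping the positive vector [u] to a positive vector, hence
    inverse-positive.  This gives [delta > 0] (otherwise [Delta <= 0], while
    [Delta] is orthogonal to [u]) and [w > 0] for [theta <= 1].  The remainder
    bound then keeps the residual of the normalized [w] with respect to the old
    [lambda] positive, i.e. [lambda' > lambda]; the same bound at full step shows
    that a failed test forces [eta_k < 1].  For the upper bound, pair
    [lambda' v <= calA(v) v] with the unit vector [v]. *)
Require Import Defs.
From mathcomp Require Import all_boot all_order all_algebra.
From mathcomp Require Import classical_sets reals.
From mathcomp Require Import ring lra.

Set Implicit Arguments.
Unset Strict Implicit.
Unset Printing Implicit Defensive.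

Import Order.TTheory GRing.Theory Num.Theory.
Local Open Scope ring_scope.

(** * Entrywise order and minimum *)

Lemma entry_leP (R : realType) (n : nat) (x y : 'cV[R]_n) :
  reflect (forall i, x i ord0 <= y i ord0) (entry_le x y).
Proof.
apply: (iffP forallP) => [h i|h i]; first exact: (forallP (h i)).
by apply/forallP => j; rewrite ord1.
Qed.

Lemma entry_ltP (R : realType) (n : nat) (x y : 'cV[R]_n) :
  reflect (forall i, x i ord0 < y i ord0) (entry_lt x y).
Proof.
apply: (iffP forallP) => [h i|h i]; first exact: (forallP (h i)).
by apply/forallP => j; rewrite ord1.
Qed.

Lemma vmin_le (R : realType) (n : nat) (v : 'cV[R]_n.+1) i : vmin v <= v i ord0.
Proof. exact: bigmin_le_cond. Qed.

Lemma vmin_attained (R : realType) (n : nat) (v : 'cV[R]_n.+1) :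
  exists i, vmin v = v i ord0.
Proof.
rewrite /vmin; elim/big_ind: _ => [|x y [i ->] [j ->]|i _]; first by exists ord0.
- by case: (leP (v i ord0) (v j ord0)) => _; [exists i | exists j].
- by exists i.
Qed.

(** * Euclidean norm and operator norm *)

Section Norm2.
Variables (R : realType) (n : nat).
Implicit Types x y u : 'cV[R]_n.

Lemma norm2_ge0 x : 0 <= norm2 x.
Proof. exact: sqrtr_ge0. Qed.

Lemma norm2_sqr x : norm2 x ^+ 2 = \sum_i x i ord0 ^+ 2.
Proof. by rewrite sqr_sqrtr // sumr_ge0 // => i _; rewrite sqr_ge0. Qed.

Lemma normr_entry_le_norm2 x i : `|x i ord0| <= norm2 x.
Proof.
rewrite -sqrtr_sqr ler_wsqrtr // (bigD1 i) //= lerDl.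
by rewrite sumr_ge0 // => j _; rewrite sqr_ge0.
Qed.

Lemma ler_norm2 x y :
  (forall i, `|x i ord0| <= `|y i ord0|) -> norm2 x <= norm2 y.
Proof.
move=> xy; rewrite ler_wsqrtr // ler_sum // => i _.
by rewrite -(real_normK (num_real (x i ord0))) -(real_normK (num_real (y i ord0)))
  lerXn2r ?nnegrE.
Qed.

Lemma norm2Z c x : norm2 (c *: x) = `|c| * norm2 x.
Proof.
rewrite /norm2 -sqrtr_sqr -sqrtrM ?sqr_ge0 // mulr_sumr.
by congr Num.sqrt; apply: eq_bigr => i _; rewrite mxE exprMn.
Qed.

Lemma norm2_normalize2 x : 0 < norm2 x -> norm2 (normalize2 x) = 1.
Proof.
move=> x0; rewrite norm2Z ger0_norm ?invr_ge0 ?norm2_ge0 //.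
by rewrite mulVf // gt_eqF.
Qed.

Lemma norm2_unitD_sqr u x t : norm2 u = 1 -> \sum_i u i ord0 * x i ord0 = 0 ->
  norm2 (u + t *: x) ^+ 2 = 1 + t ^+ 2 * norm2 x ^+ 2.
Proof.
move=> u1 ux; have := norm2_sqr u; rewrite u1 expr1n => su.
(* The added zero is written as the cross term [2 * t] times the vanishing inner product, so the
   identity can be checked termwise. *)
rewrite !norm2_sqr su -[RHS]addr0 -[X in _ = _ + X](mulr0 (2 * t)) -[X in 2 * t * X]ux.
rewrite !mulr_sumr -!big_split /=.
by apply: eq_bigr => i _; rewrite !mxE; ring.
Qed.

(** Cauchy-Schwarz: with [c] the inner product, [x - c *: u] has squared norm
    [norm2 x ^+ 2 - c ^+ 2]. *)
Lemma unit_dot_le_norm2 u x : norm2 u = 1 ->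
  \sum_i u i ord0 * x i ord0 <= norm2 x.
Proof.
move=> u1; have := norm2_sqr u; rewrite u1 expr1n => su.
move cE: (\sum_i _) => c.
have c2 : c ^+ 2 <= norm2 x ^+ 2.
  rewrite -subr_ge0.
  have -> : norm2 x ^+ 2 - c ^+ 2 = \sum_i (x i ord0 - c * u i ord0) ^+ 2.
    have -> : norm2 x ^+ 2 - c ^+ 2 = norm2 x ^+ 2 - (c + c) * c + c ^+ 2 * 1.
      by ring.
    rewrite norm2_sqr su -[X in (c + c) * X]cE !mulr_sumr -sumrN -!big_split /=.
    by apply: eq_bigr => i _; ring.
  by rewrite sumr_ge0 // => i _; rewrite sqr_ge0.
by have := norm2_ge0 x; nra.
Qed.

Lemma norm2_mulmx_le_opnorm2 (A : 'M[R]_n) u : norm2 u = 1 ->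
  norm2 (A *m u) <= opnorm2 A.
Proof.
move=> u1; apply: ub_le_sup; last by exists u.
exists (norm2 (\col_i \sum_j `|A i j|)) => _ [x /= x1 <-].
apply: ler_norm2 => i; rewrite !mxE [leRHS]ger0_norm ?sumr_ge0 //.
(* The supremum must be of a bounded set: entries of a unit vector have modulus at most 1, so
   absolute row sums bound the image. *)
apply: le_trans (ler_norm_sum _ _ _) (ler_sum _ _) => j _.
by rewrite normrM ler_piMr // -x1 normr_entry_le_norm2.
Qed.

End Norm2.

(** * Monotonicity of Z-matrices *)

(** Take [t] as the least ratio of [x] to [u], attained at [i]. Then [x - t *: u] is nonnegative and
    vanishes at [i], so row [i] of [J] meets it only through nonpositive entries. With [J *m u]
    positive, the sign of [J *m x] passes to [t] and hence to [x]. *)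
Lemma Zmatrix_min_row (R : realType) (n : nat) (J : 'M[R]_n.+1)
    (u x : 'cV[R]_n.+1) : Zmatrix J -> (forall i, 0 < u i ord0) ->
  exists i t, (forall j, t * u j ord0 <= x j ord0) /\
    (J *m x) i ord0 <= t * (J *m u) i ord0.
Proof.
move=> ZJ u0; have [i ti] := vmin_attained (vdiv x u).
set t := vmin _ in ti; exists i, t.
have tx j : t * u j ord0 <= x j ord0.
  by rewrite -ler_pdivlMr //; have := vmin_le (vdiv x u) j; rewrite mxE.
have tE : t * u i ord0 = x i ord0 by rewrite ti mxE divfK // gt_eqF.
split=> //; rewrite !mxE mulr_sumr ler_sum // => j _.
have [<-|ij] := eqVneq i j; first by rewrite -tE; lra.
by have := ZJ i j ij; have := tx j; nra.
Qed.

Lemma Zmatrix_monotone (R : realType) (n : nat) (J : 'M[R]_n.+1)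
    (u x : 'cV[R]_n.+1) : Zmatrix J -> (forall i, 0 < u i ord0) ->
  (forall i, 0 < (J *m u) i ord0) -> (forall i, 0 <= (J *m x) i ord0) ->
  forall i, 0 <= x i ord0.
Proof.
move=> ZJ u0 Ju0 Jx0 j; have [i [t [tx Jx]]] := Zmatrix_min_row x ZJ u0.
have t0 : 0 <= t by have := Ju0 i; have := Jx0 i; nra.
exact: le_trans (mulr_ge0 t0 (ltW (u0 j))) (tx j).
Qed.

Lemma Zmatrix_strict_monotone (R : realType) (n : nat) (J : 'M[R]_n.+1)
    (u x : 'cV[R]_n.+1) : Zmatrix J -> (forall i, 0 < u i ord0) ->
  (forall i, 0 < (J *m u) i ord0) -> (forall i, 0 < (J *m x) i ord0) ->
  forall i, 0 < x i ord0.
Proof.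
move=> ZJ u0 Ju0 Jx0 j; have [i [t [tx Jx]]] := Zmatrix_min_row x ZJ u0.
have t0 : 0 < t by have := Ju0 i; have := Jx0 i; nra.
exact: lt_le_trans (mulr_gt0 t0 (u0 j)) (tx j).
Qed.

(** * The nonlinear operator and its Newton step *)

Section Newton.
Variables (R : realType) (n : nat) (A : 'M[R]_n.+1) (Gamma : R).
Variable a : 'cV[R]_n.+1.
Hypotheses (a0 : forall i, 0 < a i ord0) (Gamma0 : 0 < Gamma).
Implicit Types u v x : 'cV[R]_n.+1.

Lemma calA_mulE u x i : (calA A Gamma a u *m x) i ord0 =
  (A *m x) i ord0 + Gamma * (1 - (a i ord0 + u i ord0 ^+ 2)^-1) * x i ord0.
Proof.
rewrite mulmxDl mxE; congr (_ + _).
by rewrite -scalemxAl mxE /vdiag mul_diag_mx !mxE mul1r mulrA.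
Qed.

Lemma residE u l i :
  resid A Gamma a u l i ord0 = (calA A Gamma a u *m u) i ord0 - l * u i ord0.
Proof. by rewrite [LHS]mxE; congr (_ + _); rewrite !mxE. Qed.

(** Writing [a - u^2] as [(a + u^2) - 2 * u^2] splits the Jacobian diagonal into that of [calA] and
    a nonnegative excess. *)
Lemma jacobian_mulE u l x i : (jacobian A Gamma a u l *m x) i ord0 =
  (calA A Gamma a u *m x) i ord0 - l * x i ord0 +
  2 * Gamma * u i ord0 ^+ 2 / (a i ord0 + u i ord0 ^+ 2) ^+ 2 * x i ord0.
Proof.
have d0 : a i ord0 + u i ord0 ^+ 2 != 0.
  by rewrite gt_eqF // ltr_pwDl ?sqr_ge0.
rewrite calA_mulE /jacobian mulmxBl mulmxDl mul_scalar_mx -scalemxAl /vdiag mul_diag_mx.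
rewrite !mxE.
by field.
Qed.

Lemma jacobian_Zmatrix u l : Zmatrix A -> Zmatrix (jacobian A Gamma a u l).
Proof.
move=> ZA i j ij; have := ZA i j ij.
by rewrite !mxE (negbTE ij) !mulr0n mulr0 subr0 addr0.
Qed.

Lemma lambda_min_resid_ge0 u i : (forall j, 0 < u j ord0) ->
  0 <= resid A Gamma a u (lambda_min A Gamma a u) i ord0.
Proof.
move=> u0; rewrite residE subr_ge0 -ler_pdivlMr //.
by have := vmin_le (vdiv (calA A Gamma a u *m u) u) i; rewrite [X in _ <= X]mxE.
Qed.

Lemma lambda_min_resid_eq0 u : (forall j, 0 < u j ord0) ->
  exists i, resid A Gamma a u (lambda_min A Gamma a u) i ord0 = 0.
Proof.
move=> u0; have [i e] := vmin_attained (vdiv (calA A Gamma a u *m u) u).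
exists i; rewrite residE /lambda_min e [vdiv _ _ i ord0]mxE.
by rewrite divfK ?subrr // gt_eqF.
Qed.

Lemma lt_lambda_min u l : (forall j, 0 < u j ord0) ->
  (forall i, 0 < resid A Gamma a u l i ord0) -> l < lambda_min A Gamma a u.
Proof.
move=> u0 r0; have [i e] := vmin_attained (vdiv (calA A Gamma a u *m u) u).
rewrite /lambda_min e [vdiv _ _ i ord0]mxE ltr_pdivlMr // -subr_gt0 -residE.
exact: r0.
Qed.

Lemma lambda_min_lt_opnorm2 v : (forall j, 0 < v j ord0) -> norm2 v = 1 ->
  lambda_min A Gamma a v < opnorm2 A + Gamma.
Proof.
move=> v0 v1; have := norm2_sqr v; rewrite v1 expr1n => sv.
apply: (@lt_le_trans _ _ (\sum_i v i ord0 * (A *m v) i ord0 + Gamma)); last first.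
  by rewrite lerD2r (le_trans (unit_dot_le_norm2 _ v1)) // norm2_mulmx_le_opnorm2.
(* Both scalars are multiplied by 1, the sum of the squares of [v], to compare termwise; strictness
   comes from [Gamma * d * z ^+ 2]. *)
rewrite -[ltLHS]mulr1 -[X in _ < _ + X]mulr1 sv !mulr_sumr -big_split /=.
apply: ltr_sum => [|i _]; first by apply/hasP; exists ord0; rewrite ?mem_index_enum.
have := lambda_min_resid_ge0 i v0; rewrite residE calA_mulE.
have : 0 < (a i ord0 + v i ord0 ^+ 2)^-1 by rewrite invr_gt0 ltr_pwDl ?sqr_ge0.
have := v0 i; set l := lambda_min _ _ _ _; set d := _^-1; set y := (A *m v) i _.
set z := v i _ => z0 d0 h.
have : 0 < Gamma * d * z ^+ 2 by rewrite !mulr_gt0 ?exprn_gt0.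
by have := mulr_ge0 (ltW z0) h; nra.
Qed.

Section Step.
Variables (u Delta : 'cV[R]_n.+1) (delta : R).
Let l := lambda_min A Gamma a u.
Hypotheses (ZA : Zmatrix A) (u0 : forall i, 0 < u i ord0).
Hypothesis (step : newton_step A Gamma a u l Delta delta).

Lemma newton_step_jacobian i : (jacobian A Gamma a u l *m Delta) i ord0 =
  delta * u i ord0 - resid A Gamma a u l i ord0.
Proof.
have := step; rewrite /newton_step mul_block_col opp_col_mx => /eq_col_mx[h _].
have := congr1 (fun x : 'cV[R]__ => x i ord0) h.
rewrite mul_mx_scalar; move: (jacobian _ _ _ _ _ *m Delta) (resid _ _ _ _ _).
by move=> p q; rewrite !mxE; lra.
Qed.

Lemma newton_step_orthogonal : norm2 u = 1 ->
  \sum_i u i ord0 * Delta i ord0 = 0.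
Proof.
move=> u1; have := norm2_sqr u; rewrite u1 expr1n => su.
have := step; rewrite /newton_step mul_block_col opp_col_mx => /eq_col_mx[_ h].
have := congr1 (fun x : 'cV[R]__ => x ord0 ord0) h.
rewrite mul0mx addr0 mulNmx !mxE.
rewrite [X in _ = - (_ * (_ - X))](_ : _ = 1); last first.
  by rewrite su; apply: eq_bigr => i _; rewrite mxE expr2.
rewrite subrr mulr0 oppr0 => /eqP; rewrite oppr_eq0 => /eqP uD; rewrite -[RHS]uD.
by apply: eq_bigr => i _; rewrite mxE.
Qed.

Lemma jacobian_mul_gt0 i : 0 < (jacobian A Gamma a u l *m u) i ord0.
Proof.
rewrite jacobian_mulE -residE ltr_wpDl ?lambda_min_resid_ge0 //.
by rewrite !mulr_gt0 ?invr_gt0 ?exprn_gt0 // ltr_pwDl ?sqr_ge0.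
Qed.

(** If [delta <= 0], the Jacobian sends [- Delta] to a nonnegative vector, so [Delta <= 0];
    orthogonality to [u] gives [Delta = 0]. Then the residual is [delta *: u], and its zero entry
    forces it to vanish. *)
Lemma newton_step_delta_gt0 : norm2 u = 1 -> resid A Gamma a u l != 0 ->
  0 < delta.
Proof.
move=> u1 rn0; rewrite ltNge; apply/negP => d0.
have r0 i : 0 <= resid A Gamma a u l i ord0 by exact: lambda_min_resid_ge0.
have D0 i : 0 <= (- Delta) i ord0.
  apply: Zmatrix_monotone (jacobian_Zmatrix u l ZA) u0 jacobian_mul_gt0 _ i => j.
  by rewrite mulmxN mxE newton_step_jacobian; have := r0 j; have := u0 j; nra.
have DE i : Delta i ord0 = 0.
  have uD0 j : true -> 0 <= u j ord0 * (- Delta) j ord0.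
    by rewrite mulr_ge0 // ltW.
  have : \sum_j u j ord0 * (- Delta) j ord0 == 0.
    rewrite -oppr_eq0 -sumrN -[eqbRHS](newton_step_orthogonal u1).
    by apply/eqP; apply: eq_bigr => j _; rewrite mxE mulrN opprK.
  rewrite psumr_eq0 // => /allP/(_ i (mem_index_enum _)).
  by rewrite mulf_eq0 (gt_eqF (u0 i)) mxE oppr_eq0 => /eqP.
have Dz : Delta = 0 by apply/colP => i; rewrite DE mxE.
have rE i : resid A Gamma a u l i ord0 = delta * u i ord0.
  have := newton_step_jacobian i; rewrite Dz mulmx0 [LHS]mxE => /eqP.
  by rewrite eq_sym subr_eq0 => /eqP.
have [i ri] := lambda_min_resid_eq0 u0.
have dz : delta = 0.
  have := rE i; rewrite ri => /esym/eqP.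
  by rewrite mulf_eq0 (gt_eqF (u0 i)) orbF => /eqP.
by move/eqP: rn0; apply; apply/colP => j; rewrite rE dz mul0r mxE.
Qed.

(** The Jacobian sends the update to [(1 - theta)] times the residual, plus the diagonal excess
    applied to [u], plus [theta * delta] times [u]; only the last needs to be strictly positive. *)
Lemma newton_step_update_gt0 theta i : 0 < delta -> 0 < theta <= 1 ->
  0 < (u + theta *: Delta) i ord0.
Proof.
move=> d0 /andP[t0 t1].
apply: Zmatrix_strict_monotone (jacobian_Zmatrix u l ZA) u0 jacobian_mul_gt0 _ i.
move=> j; rewrite mulmxDr -scalemxAr mxE [X in _ + X]mxE.
rewrite newton_step_jacobian jacobian_mulE -residE.
have r0 : 0 <= resid A Gamma a u l j ord0 by exact: lambda_min_resid_ge0.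
have := mulr_gt0 t0 (mulr_gt0 d0 (u0 j)).
set c := _ / _ * _.
have c0 : 0 <= c.
  by rewrite !mulr_ge0 ?invr_ge0 ?exprn_ge0 ?sqr_ge0 ?(ltW Gamma0) ?(ltW (u0 j)) //
    addr_ge0 ?sqr_ge0 ?ltW.
by move=> h; nra.
Qed.

(** The norm bound controls each entry of [Rvec], and the nonnegative residual term is dropped. *)
Lemma hvec_ge M theta i : remainder_bound A Gamma a M -> norm2 u = 1 ->
  0 < theta <= 1 ->
  theta * delta / norm2 (u + theta *: Delta) * u i ord0
    - M * theta ^+ 2 * norm2 Delta ^+ 2 <= hvec A Gamma a u l Delta theta i ord0.
Proof.
move=> bnd u1 t01; have u0' : entry_lt 0 u by apply/entry_ltP => j; rewrite mxE.
have := le_trans (normr_entry_le_norm2 _ i) (bnd u Delta delta theta u0' u1 step t01).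
rewrite -/l ler_norml => /andP[+ _]; rewrite /Rvec.
have : 0 <= (1 - theta) / norm2 (u + theta *: Delta) * resid A Gamma a u l i ord0.
  case/andP: t01 => _ t1.
  by rewrite mulr_ge0 ?divr_ge0 ?norm2_ge0 ?subr_ge0 ?lambda_min_resid_ge0.
move: (hvec _ _ _ _ _ _ _) (resid _ _ _ _ _) => h r.
by rewrite !mxE; lra.
Qed.

End Step.
End Newton.

(** * The step rule and the eigenvalue bounds *)

Theorem theorem2p5 (R : realType) (n : nat) (A : 'M[R]_n.+1)
    (a : 'cV[R]_n.+1) (Gamma eta M : R)
    (u Delta : 'cV[R]_n.+1) (delta theta : R) :
  Mmatrix A -> irreducible_mx A ->
  entry_lt 0 a -> 0 < Gamma -> 0 < eta ->
  0 < M -> remainder_bound A Gamma a M ->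
  entry_lt 0 u -> norm2 u = 1 ->
  let lambda := lambda_min A Gamma a u in
  resid A Gamma a u lambda != 0 ->
  newton_step A Gamma a u lambda Delta delta ->
  0 < theta ->
  let w := u + theta *: Delta in
  let full := full_step_test A Gamma a u lambda Delta delta eta w in
  let eta_k := damped_step u Delta delta eta M w in
  theta = (if full then 1 else eta_k) ->
  let lambda' := lambda_min A Gamma a (normalize2 w) in
  (~~ full -> 0 < eta_k < 1)
  /\ lambda < lambda' < opnorm2 A + (1 + n.+1%:R) * Gamma.
Proof.
case=> ZA _ _ _ /entry_ltP a0' Gamma0 eta0 M0 bnd /entry_ltP u0' u1 lambda rn0 step.
move=> theta0 w full eta_k thetaE lambda'.
have a0 i : 0 < a i ord0 by have := a0' i; rewrite mxE.
have u0 i : 0 < u i ord0 by have := u0' i; rewrite mxE.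
have delta0 : 0 < delta by exact: newton_step_delta_gt0 step u1 rn0.
have normE t : norm2 (u + t *: Delta) ^+ 2 = 1 + t ^+ 2 * norm2 Delta ^+ 2.
  exact: norm2_unitD_sqr (newton_step_orthogonal step u1).
have norm_gt0 t : 0 < norm2 (u + t *: Delta).
  have := normE t; have := norm2_ge0 (u + t *: Delta).
  by have := mulr_ge0 (sqr_ge0 t) (sqr_ge0 (norm2 Delta)); nra.
have w0 : 0 < norm2 w by exact: norm_gt0.
have eta1 : 0 < 1 + eta by rewrite addr_gt0.
have damped : ~~ full ->
    M * theta * norm2 Delta ^+ 2 = eta * delta * vmin u / ((1 + eta) * norm2 w).
  move=> /negbTE nfull; have tE : theta = eta_k by rewrite thetaE nfull.
  (* If [Delta] were zero, the convention for division by 0 would give [eta_k = 0], against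
     [theta > 0]. *)
  have D0 : norm2 Delta != 0.
    apply/eqP => D0; move: theta0; rewrite tE /eta_k /damped_step D0.
    by rewrite expr0n mulr0 invr0 mulr0 ltxx.
  rewrite tE /eta_k /damped_step; field.
  by rewrite D0 !gt_eqF.
(* Since [vmin u] is at most each entry, the remainder costs at most the share [eta / (1 + eta)] of
   the gain; the share [1 / (1 + eta)] left is the test threshold. *)
have margin i : delta / norm2 w * u i ord0
    - eta * delta * vmin u / ((1 + eta) * norm2 w)
    >= delta / ((1 + eta) * norm2 w) * u i ord0.
  rewrite -subr_ge0 [X in 0 <= X](_ : _ =
    eta * delta / ((1 + eta) * norm2 w) * (u i ord0 - vmin u)); last first.
    by field; rewrite !gt_eqF.
  by rewrite mulr_ge0 ?subr_ge0 ?vmin_le // divr_ge0 // mulr_ge0 // ltW.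
have eta_k_lt1 : ~~ full -> 0 < eta_k < 1.
  move=> nfull; have tE : theta = eta_k by rewrite thetaE (negbTE nfull).
  (* If [theta >= 1], the step of length 1 has a norm at most that of [w] and a remainder at most
     [M * theta * norm2 Delta ^+ 2], so the full step would pass the test. *)
  rewrite -tE theta0 ltNge /=; apply/negP => theta1.
  move/negP: (nfull); apply; apply/entry_leP => i; rewrite mxE.
  apply: le_trans (margin i) _.
  apply: le_trans (hvec_ge u0 step i bnd u1 _); last by rewrite ltr01 lexx.
  rewrite -damped // expr1n mulr1 mul1r.
  have w1_le : norm2 (u + 1 *: Delta) <= norm2 w.
    rewrite -ler_sqr ?nnegrE ?norm2_ge0 // !normE expr1n lerD2l.
    by rewrite ler_wpM2r ?sqr_ge0 // expr_ge1 // ltW.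
  apply: lerB.
    by rewrite ler_pM2r // ler_pM2l // lef_pV2 // posrE norm_gt0.
  by rewrite ler_wpM2r ?sqr_ge0 // ler_peMr // ltW.
split=> //.
have theta01 : 0 < theta <= 1.
  rewrite theta0 thetaE; case: (boolP full) => [_|/eta_k_lt1 /andP[_ /ltW //]].
  exact: lexx.
have wpos i : 0 < w i ord0.
  exact: (newton_step_update_gt0 a0 Gamma0 ZA u0 step i delta0 theta01).
have vpos i : 0 < normalize2 w i ord0 by rewrite mxE mulr_gt0 ?invr_gt0.
apply/andP; split; last first.
  apply: lt_le_trans (lambda_min_lt_opnorm2 A a0 Gamma0 vpos _) _.
    exact: norm2_normalize2.
  by rewrite lerD2l ler_peMl ?(ltW Gamma0) // lerDl.
apply: lt_lambda_min vpos _ => i.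
have mpos : 0 < delta / ((1 + eta) * norm2 w) * u i ord0.
  by rewrite mulr_gt0 // divr_gt0 // mulr_gt0.
case: (boolP full) => [fullT|nfull].
  move: (fullT) => /entry_leP/(_ i); rewrite mxE => /(lt_le_trans mpos).
  by rewrite /hvec -/lambda /w thetaE fullT.
apply: lt_le_trans (hvec_ge u0 step i bnd u1 theta01).
(* Factoring out [theta] leaves a remainder linear in [theta], which [damped] evaluates exactly. *)
rewrite [X in 0 < X](_ : _ = theta * (delta / norm2 w * u i ord0
    - M * theta * norm2 Delta ^+ 2)); last by rewrite /w; ring.
by rewrite mulr_gt0 // damped // (lt_le_trans mpos).
Qed.
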